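(* For any winning-additive analytic wedge $A$ in a Polish group $X$ the following conditions are equivalent: (1) the subgroup $A-A$ is not open in $X$; (2) $A-A$ is meager in $X$; (3) $A$ is generically Haar-$1$; (4) $A$ is Haar-thin; (5) $A$ is null-finite; (6) $A$ is Haar-countable.
   Context: All groups are Abelian, written additively, with neutral element $\theta$; a Polish group is a topological group whose underlying space is Polish. $\mathbb N=\{1,2,\dots\}$. A space is analytic if it is a continuous image of a Polish space. $A$ is additive if $A+A\subset A$. Wedges. A subset $M\subset\mathbb N$ is multiplicative if $M\cdot M\subset M$; for such $M$ put $\frac{\theta}{M}:=\{\theta\}\cup\bigcup_{m\in M}\{x\in X:mx=\theta\}$. A nonempty subset $A\subset X$ is an $M$-wedge if $A$ is additive, $A=A+\frac{\theta}{M}$, and for any points $a,b\in A$ and any neighborhood $U\subset X$ of $\theta$ there are points $u,v\in A\cap U$ such that $a=mu$ and $b=mv$ for some $m\in M$. $A$ is a wedge if it is an $M$-wedge for some multiplicative $M\subset\mathbb N$. A wedge is analytic if its underlying space is analytic. Addition Game. For an additive set $A\subset X$ with $\theta\in\overline A$, in the $n$-th inning ($n=1,2,\dots$) player I selects a neighborhood $U_n\subset X$ of $\theta$ and player II responds by selecting a point $a_n\in U_n\cap A$. Player I wins if the series $\sum_{n=1}^\infty a_n$ converges to some point of $A$; otherwise II wins. An additive set $A$ is winning-additive if $\theta\in\overline A$ and player I has a winning strategy in this game, i.e. there is a function assigning to each finite sequence $(a_1,\dots,a_n)$ of points of $A$ (including the empty one) a neighborhood $S(a_1,\dots,a_n)$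 of $\theta$ in $X$ such that for every sequence $(a_n)_{n\ge1}$ in $A$ with $a_n\in S(a_1,\dots,a_{n-1})$ for all $n\in\mathbb N$ the series $\sum_{n=1}^\infty a_n$ converges to a point of $A$. Smallness notions for $A\subset X$ ($2^\omega=\{0,1\}^\omega$ is the Cantor cube). Generically Haar-$1$: the set $\{f\in C(2^\omega,X):\forall x\in X\;|f^{-1}(A+x)|\le1\}$ is comeager in the space $C(2^\omega,X)$ of continuous maps with the compact-open topology. Haar-thin: there is a continuous $f:2^\omega\to X$ such that for every $x\in X$ the set $f^{-1}(A+x)$ is thin, where $T\subset2^\omega$ is thin if for every $n\in\omega$ the map $T\ni x\mapsto x|_{\omega\setminus\{n\}}$ is injective. Null-finite: there is a continuous map $f:\omega+1\to X$ ($\omega+1$ with the order topology) such that $f^{-1}(A+x)$ is finite for every $x\in X$. Haar-countable: there is a continuous map $f:2^\omega\to X$ such that $f^{-1}(A+x)$ is countable for every $x\in X$. *)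

(* Defs.v *)
From HB Require Import structures.
From mathcomp Require Import all_boot all_order all_algebra.
From mathcomp Require Import all_classical all_reals.
From mathcomp Require Import topology tvs sequences cantor.

Set Implicit Arguments.
Unset Strict Implicit.
Unset Printing Implicit Defensive.

Import Order.TTheory GRing.Theory Num.Theory.

Local Open Scope classical_set_scope.
Local Open Scope ring_scope.

Section TopologicalNotions.

Definition homeomorphic (S T : topologicalType) : Prop :=
  exists (f : S -> T) (g : T -> S),
    [/\ cancel f g, cancel g f, continuous f & continuous g].

Definition complete_metric_space (R : realType) (M : metricType R) : Prop :=
  forall F : set_system M, ProperFilter F -> cauchy F -> exists l : M, F --> l.

Definition separable (T : topologicalType) : Prop :=
  exists2 D : set T, countable D & dense D.

Definition completely_metrizable (R : realType) (T : topologicalType) : Prop :=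
  exists2 M : metricType R, complete_metric_space M & homeomorphic T M.

Definition polish (R : realType) (T : topologicalType) : Prop :=
  separable T /\ completely_metrizable R T.

Definition analytic_space (R : realType) (T : topologicalType) : Prop :=
  exists (P : topologicalType) (f : P -> T),
    [/\ polish R P, continuous f & range f = [set: T]].

Definition nowhere_dense (T : topologicalType) (A : set T) : Prop :=
  interior (closure A) = set0.

Definition meager (T : topologicalType) (A : set T) : Prop :=
  exists2 F : (set T)^nat,
    (forall n, nowhere_dense (F n)) & A = \bigcup_n F n.

Definition comeager (T : topologicalType) (A : set T) : Prop :=
  meager (~` A).

(* C(T, U). The library puts the compact-open topology on the type of all
   functions; [continuousType T U] gets the topology induced from it. *)
Definition continuous_maps (T U : topologicalType) : topologicalType :=
  @initial_topology (continuousType T U) {compact-open, T -> U}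
    (fun f : continuousType T U => (f : T -> U)).

End TopologicalNotions.

(* The ordinal omega + 1: [Some n] is the finite ordinal n and [None] is the
   largest element omega. *)
Definition omega_succ : Type := option nat.

HB.instance Definition _ := Choice.on omega_succ.

Definition omega_succ_le (x y : omega_succ) : bool :=
  match x, y with
  | _, None => true
  | None, Some _ => false
  | Some m, Some n => (m <= n)%N
  end.

Lemma omega_succ_le_refl : reflexive omega_succ_le.
Proof. by case=> [n|] //=. Qed.

Lemma omega_succ_le_anti : antisymmetric omega_succ_le.
Proof. by case=> [m|] [n|] //= /anti_leq ->. Qed.

Lemma omega_succ_le_trans : transitive omega_succ_le.
Proof. by case=> [n|] [m|] [p|] //=; exact: leq_trans. Qed.

Fact omega_succ_display : Order.disp_t. Proof. exact: Order.default_display. Qed.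

HB.instance Definition _ := Order.Le_isPOrder.Build omega_succ_display
  omega_succ omega_succ_le_refl omega_succ_le_anti omega_succ_le_trans.

Lemma omega_succ_le_total : total (<=%O : rel omega_succ).
Proof. by case=> [m|] [n|] //=; exact: leq_total. Qed.

HB.instance Definition _ := Order.POrder_isTotal.Build omega_succ_display
  omega_succ omega_succ_le_total.

Section Groups.

Definition additive_set (X : zmodType) (A : set X) : Prop :=
  [set a + b | a in A & b in A] `<=` A.

Definition difference_set (X : zmodType) (A : set X) : set X :=
  [set a - b | a in A & b in A].

Definition translate (X : zmodType) (A : set X) (x : X) : set X :=
  [set a + x | a in A].

Definition multiplicative_set (M : set nat) : Prop :=
  M `<=` [set m | (0 < m)%N] /\ forall m n, M m -> M n -> M (m * n)%N.

Definition torsion_part (X : zmodType) (M : set nat) : set X :=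
  [set 0] `|` \bigcup_(m in M) [set x : X | x *+ m = 0].

Definition M_wedge (X : topologicalZmodType) (M : set nat) (A : set X) : Prop :=
  [/\ A !=set0,
      additive_set A,
      A = [set a + t | a in A & t in @torsion_part X M]
    & forall (a b : X) (U : set X), A a -> A b -> nbhs (0 : X) U ->
        exists u v : X, [/\ (A `&` U) u, (A `&` U) v
          & exists2 m, M m & a = u *+ m /\ b = v *+ m]].

Definition wedge (X : topologicalZmodType) (A : set X) : Prop :=
  exists2 M : set nat, multiplicative_set M & M_wedge M A.

(* [S [:: a_0; ...; a_(n-1)]] is the neighborhood chosen by player I after
   player II has played a_0, ..., a_(n-1); innings are numbered from 0. *)
Definition winning_additive (X : topologicalZmodType) (A : set X) : Prop :=
  [/\ additive_set A,
      closure A 0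
    & exists S : seq X -> set X,
        (forall s : seq X, [set` s] `<=` A -> nbhs (0 : X) (S s)) /\
        (forall a : X^nat, (forall n, A (a n)) ->
          (forall n, S (mkseq a n) (a n)) ->
          exists2 l : X, A l & series a @ \oo --> l)].

End Groups.

Section Smallness.
Context {X : topologicalZmodType}.
Implicit Type A : set X.

Definition generically_Haar1 A : Prop :=
  @comeager (continuous_maps cantor_space X)
    [set f : continuousType cantor_space X |
      forall x : X, is_subset1 (f @^-1` translate A x)].

Definition thin (T : set cantor_space) : Prop :=
  forall n : nat,
    set_inj T (fun x : cantor_space => sigL (~` [set n]) (x : nat -> bool)).

Definition Haar_thin A : Prop :=
  exists2 f : cantor_space -> X,
    continuous f & forall x : X, thin (f @^-1` translate A x).

Definition null_finite A : Prop :=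
  exists2 f : order_topology omega_succ -> X,
    continuous f & forall x : X, finite_set (f @^-1` translate A x).

Definition Haar_countable A : Prop :=
  exists2 f : cantor_space -> X,
    continuous f & forall x : X, countable (f @^-1` translate A x).

End Smallness.

(* Main.v *)
Require Import Defs.
From mathcomp Require Import all_boot all_order all_algebra.
From mathcomp Require Import all_classical all_reals.
From mathcomp Require Import topology tvs sequences cantor.

Set Implicit Arguments.
Unset Strict Implicit.
Unset Printing Implicit Defensive.

Import Order.TTheory GRing.Theory Num.Theory.

Local Open Scope classical_set_scope.
Local Open Scope ring_scope.

(** Put G = A - A; additivity makes G a subgroup.

The implications from smallness of G to smallness of A are Baire category
arguments. Two points s, t of the Cantor set are sent by f into one translate
of A only if f s - f t lies in G. When G is meager, a generic continuous f
sends distinct points to points whose difference avoids G, because the two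
values can be moved independently of each other so that their difference
leaves a given nowhere dense set ([difference_meager_Haar1]). The space of
continuous maps on the Cantor set is a Baire space, so such an f exists
([generic_witness]); it is a witness for the notions Haar-thin, null-finite
and Haar-countable at once.

If G is not meager, it is open: G is analytic, and B - B is a neighborhood of
zero for every nonmeager analytic set B ([suslin_pettis]). This rests on the
fact that two Suslin sets intersect when both are nonmeager in every open
subset of a common open set: a common point is found by descending along both
Suslin schemes at once ([suslin_meet]). It is applied to B and to B + x.

If G is open, A is not Haar-thin: f z - f z' lies in G as soon as z' is z with
one sufficiently far coordinate flipped. In particular an open G is not
meager, since a meager G would make A Haar-thin.

The last two notions use the wedge and the game. For a nonmeager G let B be
the part of A in a small neighborhood of zero. By the wedge property G is the
union over m in M of the sets m(B - B), and one of these is nonmeager. Its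
difference set is a neighborhood of zero, and the saturation of A under
torsion allows to divide by m: small elements of X are differences of small
elements of A ([wedge_small_differences]).

Playing the addition game against all possible histories simultaneously then
gives, for any prescribed null sequences, points a_i and b_i of A such that
a_i - b_i is a term of the i-th sequence and every series whose i-th term is
a_i or b_i converges to a point of A ([game_selection]). For a convergent
sequence x_n with limit x, prescribe the sequence x_n - x at all stages; then
x_(n_k) - x + sum b_i is the sum of the series with a_k in place of b_k, so
one translate of A contains infinitely many x_n ([not_null_finite]). For a
map f on the Cantor set, let the stages run through the nodes of a binary
tree, and prescribe at each node the differences of f under flipping a far
coordinate; telescoping along a branch y gives a point z_y with
f z_y - f 0 + sum b_i in A, and distinct branches give distinct points
([not_Haar_countable]). *)

(** * Complete sequences of covers *)

(** For decreasing E this is convergence of the filter base E to x. *)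
Definition shrinks_to (T : topologicalType) (E : nat -> set T) (x : T) : Prop :=
  forall U, nbhs x U -> exists k, E k `<=` U.

(** Complete metrics enter the argument only through such a sequence of
countable open covers: the k-th cover stands for the balls of radius 1/(k+1)
around the points of a countable dense set. *)
Definition complete_covers (T : topologicalType) (V : nat -> nat -> set T) :
    Prop :=
  [/\ forall k j, open (V k j),
      forall k x, exists j, V k j x
    & forall E : nat -> set T, (forall k, E k !=set0) ->
        (forall k, E k.+1 `<=` E k) -> (forall k, exists j, E k `<=` V k j) ->
        exists x, shrinks_to E x].

Lemma polish_complete_covers (R : realType) (T : topologicalType) :
  polish R T -> exists V : nat -> nat -> set T, complete_covers V.
Proof.
move=> [[D cD dD] [M Mcomplete [f [g [fK gK fc gc]]]]].
have [h hinj] := @countable_injP _ D cD.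
pose r (k : nat) : R := k.+1%:R^-1.
have r0 k : 0 < r k by rewrite invr_gt0 ltr0n.
(* As h is injective on D, every union below has at most one member; it is empty
   when j is not in the image of D. *)
exists (fun k j => \bigcup_(d in [set d | D d /\ h d = j])
  (f @^-1` (ball (f d) (r k))^°)); split.
- move=> k j; apply: bigcup_open => d _.
  by apply: open_comp => [x _|]; [exact: fc|exact: open_interior].
- move=> k x.
  have r20 : 0 < r k / 2 by rewrite divr_gt0.
  have [| |d []] := dD (f @^-1` (ball (f x) (r k / 2))^°).
  + exists x => /=; exact: nbhsx_ballx.
  + apply: open_comp => [y _|]; [exact: fc|exact: open_interior].
  move=> /= /interior_subset xd Dd; exists (h d); exists d => //=.
  apply: filterS (nbhsx_ballx (f x) _ r20) => y xy.
  rewrite (splitr (r k)); apply: ball_triangle xy.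
  exact: ball_sym.
- (* The images of the sets E k generate a Cauchy filter in the metric space. *)
  move=> E E0 Edec Esub.
  have Emono i j : (i <= j)%N -> E j `<=` E i.
    elim: j => [|j IH]; first by rewrite leqn0 => /eqP ->.
    rewrite leq_eqVlt ltnS => /orP[/eqP -> //|/IH]; exact: subset_trans.
  pose F := filter_from [set: nat] (fun k => f @` E k).
  have FF : ProperFilter F.
    apply: filter_from_proper; last first.
      by move=> k _; have [x Ex] := E0 k; exists (f x), x.
    apply: filter_fromT_filter; first by exists 0%N.
    move=> i j; exists (maxn i j) => _ [x Ex <-].
    by split; exists x => //; apply: Emono Ex; rewrite ?leq_maxl ?leq_maxr.
  have Fcauchy : cauchy F.
    apply: cauchy_exP => e e0.
    have [k ke] : exists k, r k < e.
      exists (Num.truncn e^-1); rewrite /r invf_plt ?posrE //; exact: truncnS_gt.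
    have [j Ej] := Esub k; have [x Ex] := E0 k.
    have [d [Dd hd] _] := Ej _ Ex; exists (f d); exists k => // _ [y Ey <-].
    have [d' [Dd' hd'] /interior_subset /=] := Ej _ Ey.
    have -> : d' = d by apply: hinj; rewrite ?inE // hd hd'.
    by apply: le_ball; exact: ltW.
  have [l Fl] := Mcomplete F FF Fcauchy; exists (g l) => U Ug.
  have [k _ kU] := Fl _ (gc l _ Ug); exists k => x Ex.
  by rewrite -(fK x); apply: (kU (f x)); exists x.
Qed.

Lemma polish_hausdorff (R : realType) (T : topologicalType) :
  polish R T -> hausdorff_space T.
Proof.
move=> [_ [M _ [f [g [fK gK fc gc]]]]] p q pq.
rewrite -(fK p) -(fK q); congr g; apply: (@metric_hausdorff _ M) => A B Ap Bq.
have [x [Ax Bx]] := pq _ _ (fc p _ Ap) (fc q _ Bq).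
by exists (f x).
Qed.

(** * Meager sets *)

Section Meager.
Context {T : topologicalType}.
Implicit Types A B O : set T.

Lemma nowhere_denseP A : nowhere_dense A <->
  forall O, open O -> O !=set0 ->
    exists O', [/\ open O', O' !=set0, O' `<=` O & forall x, O' x -> ~ A x].
Proof.
split=> [nA O Oo [x Ox]|H].
  exists (O `&` ~` closure A); split.
  - by apply: openI => //; apply: closed_openC; exact: closed_closure.
  - apply: contrapT => /nonemptyPn/seteqP[E _].
    suff : interior (closure A) x by rewrite nA.
    rewrite /interior nbhsE; exists O => // y Oy; apply: contrapT => nAy.
    by have := E y; apply.
  - by move=> y [].
  - by move=> y [_ nAy] Ay; apply: nAy; exact: subset_closure.
apply: contrapT => /eqP/set0P ne.
have [O' [O'o [x O'x] O'sub O'A]] := H _ (open_interior _) ne.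
have [y [Ay O'y]] : (A `&` O') !=set0.
  by apply: (interior_subset (O'sub _ O'x)); exact: open_nbhs_nbhs.
exact: O'A O'y Ay.
Qed.

Lemma nowhere_dense_sub A B : A `<=` B -> nowhere_dense B -> nowhere_dense A.
Proof.
move=> AB /nowhere_denseP nB; apply/nowhere_denseP => O Oo O0.
have [O' [? ? ? O'B]] := nB O Oo O0; exists O'; split => // x /O'B nBx /AB.
exact: nBx.
Qed.

Lemma meager_sub A B : A `<=` B -> meager B -> meager A.
Proof.
move=> AB [F Fn BE]; exists (fun n => F n `&` A).
  by move=> n; apply: nowhere_dense_sub (Fn n); exact: subIsetl.
by rewrite -setI_bigcupl -BE setIidr.
Qed.

Lemma nowhere_dense_meager A : nowhere_dense A -> meager A.
Proof. by move=> nA; exists (fun=> A) => //; rewrite bigcup_const //; exists 0%N. Qed.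

Lemma nowhere_dense0 : nowhere_dense (@set0 T).
Proof.
rewrite /nowhere_dense closure0.
by apply/seteqP; split => // x /interior_subset.
Qed.

Lemma meager0 : meager (@set0 T).
Proof. exact: nowhere_dense_meager nowhere_dense0. Qed.

Lemma meager_bigcup (I : countType) (F : I -> set T) :
  (forall i, meager (F i)) -> meager (\bigcup_i F i).
Proof.
move=> mF.
have /choice[G GP] i : exists G : nat -> set T,
    (forall n, nowhere_dense (G n)) /\ F i = \bigcup_n G n.
  by have [G ? ?] := mF i; exists G.
exists (fun n => if unpickle n is Some (i, m) then G i m else set0).
  move=> n; case: unpickle => [[i m]|]; first exact: (GP i).1.
  exact: nowhere_dense0.
apply/seteqP; split=> [x [i _]|x [n _]].
  rewrite (GP i).2 => -[m _ Gx]; exists (pickle (i, m)) => //=.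
  by rewrite pickleK.
case: unpickle => [[i m] Gx|//]; exists i => //.
by rewrite (GP i).2; exists m.
Qed.

Lemma meagerU A B : meager A -> meager B -> meager (A `|` B).
Proof.
move=> mA mB; apply: (@meager_sub _ (\bigcup_b (if b then A else B))).
  by move=> x [Ax|Bx]; [exists true|exists false].
by apply: meager_bigcup => -[].
Qed.

Definition everywhere_nonmeager A O : Prop :=
  forall O', open O' -> O' !=set0 -> O' `<=` O -> ~ meager (A `&` O').

Lemma everywhere_nonmeager_sub A O O' :
  O' `<=` O -> everywhere_nonmeager A O -> everywhere_nonmeager A O'.
Proof. by move=> sO AO P Po P0 /subset_trans/(_ sO); exact: AO. Qed.

End Meager.

Lemma meager_homeo (T S : topologicalType) (f : T -> S) (g : S -> T) (A : set T) :
  cancel f g -> cancel g f -> continuous f -> continuous g ->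
  meager A -> meager (g @^-1` A).
Proof.
move=> fK gK fc gc [F Fn ->]; exists (fun n => g @^-1` F n); last first.
  by rewrite preimage_bigcup.
move=> n; apply/nowhere_denseP => O Oo [y Oy].
have /nowhere_denseP/(_ (f @^-1` O)) [] := Fn n.
- by apply: open_comp => // x _; exact: fc.
- by exists (g y); rewrite /preimage /= gK.
move=> P [Po [x Px] PO PF]; exists (g @^-1` P); split.
- by apply: open_comp => // z _; exact: gc.
- by exists (f x); rewrite /preimage /= fK.
- by move=> z /= /PO /=; rewrite gK.
- by move=> z /PF.
Qed.

(** * Countable bases from complete covers *)

Section CountableBase.
Context {T : topologicalType} (V : nat -> nat -> set T).
Hypothesis TV : complete_covers V.
Hypothesis Th : hausdorff_space T.

(** The cells form at the same time a Suslin scheme for the whole space and a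
countable base of its topology. *)
Definition cell (s : seq nat) : set T :=
  [set x | forall k, (k < size s)%N -> V k (nth 0%N s k) x].

Lemma cell_nil : cell [::] = setT.
Proof. by apply/seteqP; split. Qed.

Lemma cell_rcons s j : cell (rcons s j) = cell s `&` V (size s) j.
Proof.
apply/seteqP; split => [x xc|x [xc xV] k].
  split=> [k ks|].
    by have := xc k; rewrite size_rcons nth_rcons ks; apply; exact: ltnW.
  by have := xc (size s); rewrite size_rcons nth_rcons ltnn eqxx; apply.
rewrite size_rcons ltnS nth_rcons => ks.
by case: ltngtP ks => // [/xc //|->].
Qed.

Lemma cell_open s : open (cell s).
Proof.
elim/last_ind: s => [|s j IH]; first by rewrite cell_nil; exact: openT.
by rewrite cell_rcons; apply: openI => //; case: TV.
Qed.

Lemma cell_split s : cell s = \bigcup_j cell (rcons s j).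
Proof.
apply/seteqP; split=> [x xs|x [j _]]; last by rewrite cell_rcons => -[].
case: TV => _ /(_ (size s) x) [j xj] _.
by exists j => //; rewrite cell_rcons.
Qed.

Lemma cell_shrinks (a : nat -> nat) :
  (forall k, cell (mkseq a k) !=set0) ->
  exists x, shrinks_to (fun k => cell (mkseq a k)) x.
Proof.
move=> ne; case: TV => _ _ complete.
have dec k : cell (mkseq a k.+1) `<=` cell (mkseq a k).
  by rewrite mkseqS cell_rcons; exact: subIsetl.
have [//|k|x xs] := complete (fun k => cell (mkseq a k.+1)) _ (fun k => dec k.+1).
  by exists (a k); rewrite mkseqS cell_rcons size_mkseq; exact: subIsetr.
by exists x => U /xs[k kU]; exists k.+1.
Qed.

(** Along a branch of cells that contain x, the cells shrink to some point, and
this point is x because no neighborhood of it misses x. *)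
Lemma cell_base x O : open O -> O x -> exists s, cell s x /\ cell s `<=` O.
Proof.
move=> Oo Ox; case: (TV) => _ cov _.
have /choice[a aP] := fun k => cov k x.
have ax k : cell (mkseq a k) x.
  by move=> i; rewrite size_mkseq => ik; rewrite nth_mkseq.
have [y ys] := cell_shrinks (fun k => ex_intro _ x (ax k)).
have xy : x = y.
  apply: Th => A B Ax By; have [k kB] := ys _ By.
  by exists x; split; [exact: nbhs_singleton|exact: kB].
have [|k kO] := ys O; first by rewrite -xy; exact: open_nbhs_nbhs.
by exists (mkseq a k).
Qed.

(** Banach category theorem: otherwise the cells that meet A in a meager set
have a dense union W, so that A is covered by the meager set A `&` W and the
nowhere dense complement of W. *)
Lemma nonmeager_somewhere (A : set T) : ~ meager A ->
  exists O, [/\ open O, O !=set0 & everywhere_nonmeager A O].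
Proof.
apply: contra_notP => noO.
pose W := \bigcup_(s in [set s | meager (A `&` cell s)]) cell s.
apply: (@meager_sub _ _ ((A `&` W) `|` ~` W)).
  by move=> x Ax; have [Wx|] := pselect (W x); [left|right].
apply: meagerU.
  apply: (@meager_sub _ _ (\bigcup_(s : seq nat)
      (if `[< meager (A `&` cell s) >] then A `&` cell s else set0))).
    by move=> x [Ax [s /= ms xs]]; exists s => //; case: asboolP.
  apply: meager_bigcup => s; case: asboolP => // _.
  exact: meager0.
apply: nowhere_dense_meager; apply/nowhere_denseP => O Oo O0.
have [P [Po [x Px] PO mP]] : exists P, [/\ open P, P !=set0, P `<=` O &
    meager (A `&` P)].
  apply: contrapT => noP; apply: noO; exists O; split => // P Po P0 PO mP.
  by apply: noP; exists P.
have [s [sx sP]] := cell_base Po Px.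
exists (cell s); split.
- exact: cell_open.
- by exists x.
- exact: subset_trans PO.
- move=> y ys; apply; exists s => //=.
  by apply: meager_sub mP; exact: setIS.
Qed.

End CountableBase.

(** * Suslin sets *)

Lemma dependent_choice_in (S : Type) (P : S -> Prop) (R : S -> S -> Prop) (x0 : S) :
  P x0 -> (forall x, P x -> exists y, P y /\ R x y) ->
  exists u : nat -> S, u 0%N = x0 /\ forall n, P (u n) /\ R (u n) (u n.+1).
Proof.
move=> P0 step.
have /choice[f fP] x : exists y, P x -> P y /\ R x y.
  by have [/step[y ?]|nP] := pselect (P x); [exists y|exists x => /nP].
exists (fun n => iter n f x0); split=> // n.
suff Pn : P (iter n f x0) by split => //; exact: (fP _ Pn).2.
by elim: n => //= n /fP[].
Qed.

Section ContinuousOperations.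
Context {T : topologicalType} {X : topologicalZmodType}.
Implicit Types f g : T -> X.

Lemma continuous_add f g :
  continuous f -> continuous g -> continuous (fun t => f t + g t).
Proof.
move=> fc gc t; apply: (@continuous_comp _ _ _ (fun t => (f t, g t))
  (fun x : X * X => x.1 + x.2)); last exact: add_continuous.
by apply: cvg_pair; [exact: fc|exact: gc].
Qed.

Lemma continuous_sub f g :
  continuous f -> continuous g -> continuous (fun t => f t - g t).
Proof.
move=> fc gc t; apply: (@continuous_comp _ _ _ (fun t => (f t, g t))
  (fun x : X * X => x.1 - x.2)); last exact: sub_continuous.
by apply: cvg_pair; [exact: fc|exact: gc].
Qed.

Lemma continuous_mulrn f m :
  continuous f -> continuous (fun t => f t *+ m).
Proof.
move=> fc; elim: m => [|m IH].
  by rewrite (_ : (fun=> _) = cst 0); [exact: cst_continuous|apply/funext].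
rewrite (_ : (fun=> _) = fun t => f t + f t *+ m); first exact: continuous_add.
by apply/funext => t; rewrite mulrS.
Qed.

End ContinuousOperations.

(** An analytic set presented by a scheme of its pieces, which avoids naming
the Polish space of which it is an image. Arbitrary countable index types make
the class visibly closed under products. *)
Definition suslin (T : topologicalType) (A : set T) : Prop :=
  exists (I : countType) (F : seq I -> set T),
    [/\ F [::] = A, forall s, F s = \bigcup_i F (rcons s i)
      & forall a : nat -> I, (forall k, F (mkseq a k) !=set0) ->
          exists2 x, A x & shrinks_to (fun k => F (mkseq a k)) x].

Lemma suslin_branch_decreasing (T : Type) (I : countType) (F : seq I -> set T) :
  (forall s, F s = \bigcup_i F (rcons s i)) ->
  forall (a : nat -> I) k l, (k <= l)%N -> F (mkseq a l) `<=` F (mkseq a k).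
Proof.
move=> Fs a k; elim=> [|l IH]; first by rewrite leqn0 => /eqP ->.
rewrite leq_eqVlt ltnS => /orP[/eqP -> //|/IH]; apply: subset_trans.
by rewrite mkseqS [X in _ `<=` X]Fs => x Fx; exists (a l).
Qed.

Lemma analytic_suslin (R : realType) (X : topologicalType) (A : set X) :
  analytic_space R (set_type A) -> suslin A.
Proof.
move=> [P [f [PP fc fA]]].
have [V PV] := polish_complete_covers PP.
pose h p := set_val (f p).
have hc : continuous h.
  move=> p; apply: (@continuous_comp _ _ _ f (@set_val _ A)); first exact: fc.
  exact: initial_continuous.
exists nat, (fun s => h @` cell V s); split.
- rewrite cell_nil; apply/seteqP; split=> [x [p _ <-]|x Ax].
    by rewrite /h; apply: set_valP.
  have : range f (SigSub (mem_set Ax)) by rewrite fA.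
  by move=> [p _ fp]; exists p => //; rewrite /h fp.
- by move=> s; rewrite (cell_split PV) image_bigcup.
- move=> a ne; have [|p pP] := @cell_shrinks _ _ PV a.
    by move=> k; have [_ [p ap _]] := ne k; exists p.
  exists (h p); first by rewrite /h; apply: set_valP.
  move=> U /hc/pP[k kU]; exists k => _ [q qa <-]; exact: kU.
Qed.

Lemma suslin_closedI (T : topologicalType) (A C : set T) :
  closed C -> suslin A -> suslin (A `&` C).
Proof.
move=> cC [I [F [F0 Fs Flim]]]; exists I, (fun s => F s `&` C); split.
- by rewrite F0.
- by move=> s; rewrite Fs setI_bigcupl.
- move=> a ne; have [k|x Ax xlim] := Flim a.
    by have [x [Fx _]] := ne k; exists x.
  exists x.
    split=> //; apply: cC => U /xlim[k kU].
    by have [y [Fy Cy]] := ne k; exists y; split => //; exact: kU.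
  by move=> U /xlim[k kU]; exists k => y [/kU].
Qed.

Lemma suslin_image2 (S T U : topologicalType) (h : S -> T -> U) (A : set S)
    (B : set T) :
  continuous (fun p : S * T => h p.1 p.2) -> suslin A -> suslin B ->
  suslin [set h a b | a in A & b in B].
Proof.
move=> hc [I [F [F0 Fs Flim]]] [J [G [G0 Gs Glim]]].
exists (I * J)%type, (fun s =>
  [set h a b | a in F [seq i.1 | i <- s] & b in G [seq i.2 | i <- s]]).
split.
- by rewrite /= F0 G0.
- move=> s; apply/seteqP; split=> [_ [a Fa [b Gb <-]]|_ [[i j] _ [a Fa [b Gb <-]]]].
    move: Fa Gb; rewrite Fs Gs => -[i _ Fa] [j _ Gb].
    by exists (i, j) => //; rewrite !map_rcons; exists a => //; exists b.
  move: Fa Gb; rewrite !map_rcons => Fa Gb; exists a; first by rewrite Fs; exists i.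
  by exists b => //; rewrite Gs; exists j.
- move=> c ne; pose ca k := (c k).1; pose cb k := (c k).2.
  have Ea k : [seq i.1 | i <- mkseq c k] = mkseq ca k by rewrite -map_comp.
  have Eb k : [seq i.2 | i <- mkseq c k] = mkseq cb k by rewrite -map_comp.
  have [k|a Aa alim] := Flim ca.
    by have [_ [a + [b _ _]]] := ne k; rewrite Ea; exists a.
  have [k|b Bb blim] := Glim cb.
    by have [_ [a' _ [b + _]]] := ne k; rewrite Eb; exists b.
  exists (h a b); first by exists a => //; exists b.
  move=> O /(hc (a, b)) [[P Q] /= [Pa Qb] PQO].
  have [k kP] := alim _ Pa; have [l lQ] := blim _ Qb.
  exists (maxn k l) => _ [x + [y + <-]]; rewrite Ea Eb => Fx Gy.
  apply: (PQO (x, y)); split => /=.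
    by apply: kP; apply: suslin_branch_decreasing Fs _ _ _ _ _ Fx; rewrite leq_maxl.
  by apply: lQ; apply: suslin_branch_decreasing Gs _ _ _ _ _ Gy; rewrite leq_maxr.
Qed.

Lemma suslin_image (S T : topologicalType) (h : S -> T) (A : set S) :
  continuous h -> suslin A -> suslin (h @` A).
Proof.
move=> hc sA; have := @suslin_image2 _ _ _ (fun a _ : S => h a) A A _ sA sA.
rewrite (_ : [set _ | _ in A & _ in A] = h @` A).
  by apply=> p; apply: (@continuous_comp _ _ _ fst h); [exact: cvg_fst|exact: hc].
by apply/seteqP; split=> [_ [a Aa [b _ <-]]|_ [a Aa <-]]; exists a => //; exists a.
Qed.

(** * Pettis' theorem for Suslin sets *)

Section Pettis.
Context {T : topologicalType} (V : nat -> nat -> set T).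
Hypothesis TV : complete_covers V.
Hypothesis Th : hausdorff_space T.

Lemma nonmeager_split (I : countType) (F : I -> set T) (O : set T) :
  open O -> O !=set0 -> everywhere_nonmeager (\bigcup_i F i) O ->
  exists i O', [/\ open O', O' !=set0, O' `<=` O & everywhere_nonmeager (F i) O'].
Proof.
move=> Oo O0 FO.
have [i mi] : exists i, ~ meager (F i `&` O).
  apply: contrapT => nF; apply: (FO O) => //.
  rewrite setI_bigcupl; apply: meager_bigcup => i.
  by apply: contrapT => mi; apply: nF; exists i.
have [P [Po P0 PF]] := nonmeager_somewhere TV Th mi.
exists i, (P `&` O); split.
- exact: openI.
- apply: contrapT => /nonemptyPn PO; apply: (PF P) => //.
  rewrite -setIA [O `&` P]setIC PO setI0; exact: meager0.
- exact: subIsetr.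
- move=> Q Qo Q0 QPO mQ; apply: (PF Q) => //.
    by move=> x /QPO[].
  by apply: meager_sub mQ => x [[]].
Qed.

(** Alternately pass to a piece of A and to a piece of B that is still nonmeager
throughout some smaller open set. The two branches converge to points of A and
of B, and these coincide since both pieces are dense in the same open sets. *)
Lemma suslin_meet (A B O : set T) :
  suslin A -> suslin B -> open O -> O !=set0 ->
  everywhere_nonmeager A O -> everywhere_nonmeager B O -> A `&` B !=set0.
Proof.
move=> [I [F [F0 Fs Flim]]] [J [G [G0 Gs Glim]]] Oo O0 AO BO.
pose P (u : seq I * seq J * set T) :=
  [/\ open u.2, u.2 !=set0, everywhere_nonmeager (F u.1.1) u.2
    & everywhere_nonmeager (G u.1.2) u.2].
pose R (u v : seq I * seq J * set T) :=
  exists i j, v.1 = (rcons u.1.1 i, rcons u.1.2 j).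
have [||u [u0 uP]] := @dependent_choice_in _ P R ([::], [::], O).
- by split=> //=; rewrite ?F0 ?G0.
- move=> [[s t] Q] [/= Qo Q0 FQ GQ].
  have [|i [Q' [Q'o Q'0 Q'Q FQ']]] := @nonmeager_split _ (fun i => F (rcons s i)) _ Qo Q0.
    by rewrite -Fs.
  have [|j [Q'' [Q''o Q''0 Q''Q GQ'']]] :=
      @nonmeager_split _ (fun j => G (rcons t j)) _ Q'o Q'0.
    by rewrite -Gs; exact: everywhere_nonmeager_sub GQ.
  exists (rcons s i, rcons t j, Q''); split; last by exists i, j.
  by split=> //=; exact: everywhere_nonmeager_sub FQ'.
have /choice[ab abP] k : exists ij : I * J,
    (u k.+1).1 = (rcons (u k).1.1 ij.1, rcons (u k).1.2 ij.2).
  by have [_ [i [j E]]] := uP k; exists (i, j).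
have Eu k : (u k).1 = (mkseq (fun k => (ab k).1) k, mkseq (fun k => (ab k).2) k).
  by elim: k => [|k IH]; rewrite ?u0 // !mkseqS abP IH.
have meets k Q : open Q -> Q `<=` (u k).2 -> Q !=set0 ->
    (F (mkseq (fun k => (ab k).1) k) `&` Q !=set0) /\
    (G (mkseq (fun k => (ab k).2) k) `&` Q !=set0).
  move=> Qo Qu Q0; have [[_ _ + +] _] := uP k; rewrite Eu /= => Fk Gk.
  by split; apply: contrapT => /nonemptyPn E; [apply: (Fk Q)|apply: (Gk Q)] => //;
    rewrite E; exact: meager0.
have uo k : open (u k).2 by have [[]] := uP k.
have un k : (u k).2 !=set0 by have [[]] := uP k.
have [k|a Aa alim] := Flim (fun k => (ab k).1).
  by have [[x [Fx _]] _] := meets k _ (uo k) (fun _ => id) (un k); exists x.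
have [k|b Bb blim] := Glim (fun k => (ab k).2).
  by have [_ [x [Gx _]]] := meets k _ (uo k) (fun _ => id) (un k); exists x.
suff ab_eq : a = b by exists a; split => //; rewrite ab_eq.
apply: Th => M N Ma Nb.
have [k kM'] := alim _ (nbhs_interior Ma); have [l lN] := blim _ Nb.
pose m := maxn k l.
have [[x [Fx ux]] _] := meets m (u m).2 (uo m) (fun _ => id) (un m).
have [|||_ [y [Gy [My _]]]] := meets m (M^° `&` (u m).2).
- by apply: openI => //; exact: open_interior.
- exact: subIsetr.
- exists x; split => //; apply: kM'.
  by apply: suslin_branch_decreasing Fs _ _ _ _ _ Fx; rewrite leq_maxl.
exists y; split; first exact: interior_subset.
apply: lN; by apply: suslin_branch_decreasing Gs _ _ _ _ _ Gy; rewrite leq_maxr.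
Qed.

End Pettis.

(** If A is nonmeager throughout O, then for x close to zero both A and A + x are
nonmeager throughout the nonempty open set O `&` (O + x), hence they meet. *)
Lemma suslin_pettis (X : topologicalZmodType) (V : nat -> nat -> set X)
    (A : set X) :
  complete_covers V -> hausdorff_space X -> suslin A -> ~ meager A ->
  nbhs (0 : X) (difference_set A).
Proof.
move=> XV Xh sA mA; have [O [Oo [p Op] AO]] := nonmeager_somewhere XV Xh mA.
have : nbhs (0 : X) [set x | O (p - x)].
  have pc : continuous (fun x : X => p - x).
    by apply: continuous_sub => x; [exact: cvg_cst|exact: cvg_id].
  by apply: (pc (0 : X)); rewrite subr0; exact: open_nbhs_nbhs.
apply: filterS => x Opx.
have subc : continuous (fun y : X => y - x).
  by apply: continuous_sub => y; [exact: cvg_id|exact: cvg_cst].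
have addc : continuous (fun y : X => y + x).
  by apply: continuous_add => y; [exact: cvg_id|exact: cvg_cst].
pose A' := [set y + x | y in A].
pose O' := O `&` (fun y => y - x) @^-1` O.
have O'o : open O' by apply: openI => //; apply: open_comp => // y _; exact: subc.
have A'O' : everywhere_nonmeager A' O'.
  move=> Q Qo [q Qq] QO' mQ.
  apply: (AO ((fun y => y + x) @^-1` Q)).
  - by apply: open_comp => // y _; exact: addc.
  - by exists (q - x); rewrite /preimage /= subrK.
  - by move=> y /QO'[_]; rewrite /preimage /= addrK.
  - have := @meager_homeo _ _ _ _ _ (fun y => subrK x y) (fun y => addrK x y) subc addc mQ.
    apply: meager_sub => y [Ay Qy]; split => //; by exists y.
have [||||||y [Ay [z Az zy]]] := @suslin_meet _ _ XV Xh A A' O' => //.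
- exact: suslin_image.
- by exists p.
- by apply: everywhere_nonmeager_sub AO; exact: subIsetl.
by exists y => //; exists z => //; rewrite -zy addrAC subrr add0r.
Qed.

(** * The Cantor space and its continuous maps *)

Section CantorSpace.
Implicit Types (z w : cantor_space) (n m : nat) (c : seq bool).

Lemma mkseq_prefix (T : Type) (a b : nat -> T) n m :
  (n <= m)%N -> mkseq a m = mkseq b m -> mkseq a n = mkseq b n.
Proof.
move=> nm E; rewrite -(subnKC nm) in E.
have F (g : nat -> T) k : mkseq g (n + k) = mkseq g n ++ mkseq (fun i => g (n + i)%N) k.
  by elim: k => [|k IH]; rewrite ?addn0 ?cats0 // addnS !mkseqS IH rcons_cat.
have := congr1 (take n) E.
by rewrite !F !take_size_cat // size_mkseq.
Qed.

(** Prefix of length n, continued by zeros if c is shorter. *)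
Definition pad n c : seq bool := mkseq (nth false c) n.

Lemma pad_mkseq z n m : (n <= m)%N -> pad n (mkseq z m) = mkseq z n.
Proof.
move=> nm; apply: (mkseq_prefix nm); rewrite -[RHS](mkseq_nth false).
by rewrite size_mkseq.
Qed.

Lemma cylinder_nbhs z n : nbhs z [set w | mkseq w n = mkseq z n].
Proof.
elim: n => [|n IH]; first by apply: filterS filterT.
have zn : nbhs z [set w : cantor_space | w n = z n].
  have := @proj_continuous nat (fun=> bool) n z [set z n].
  apply; rewrite nbhs_principalE; exact/principal_filterP.
apply: filterS2 IH zn => w /= wz wzn.
by rewrite !mkseqS wz wzn.
Qed.

(** The cylinders around z generate a filter which converges to z in each
coordinate. *)
Lemma cylinder_base z (U : set cantor_space) : nbhs z U ->
  exists n, [set w | mkseq w n = mkseq z n] `<=` U.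
Proof.
pose F := filter_from setT (fun n => [set w : cantor_space | mkseq w n = mkseq z n]).
have FF : Filter F.
  apply: filter_fromT_filter; first by exists 0%N.
  move=> i j; exists (maxn i j) => w wz; split; apply: (mkseq_prefix _ wz).
    exact: leq_maxl.
  exact: leq_maxr.
suff /[apply] : F --> z by move=> [n _ nU]; exists n.
apply/cvg_sup => i A [B [[C Co <-] Ci] CA].
exists i.+1 => // w wz; apply: CA.
have wi : w i = z i.
  by have := congr1 (fun s => nth false s i) wz; rewrite /= !nth_mkseq.
by rewrite /preimage /= /proj wi.
Qed.

(** Every point of K has a cylinder inside W; compactness gives one level that
works for all points. *)
Lemma compact_cylinders (K W : set cantor_space) : compact K -> open W -> K `<=` W ->
  exists n, forall z w, K z -> mkseq w n = mkseq z n -> W w.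
Proof.
move=> /compact_near_coveringP cK Wo KW.
pose P n z := forall w, mkseq w n = mkseq z n -> W w.
have [z Kz|n _ nP] := cK nat \oo P _.
  have [m mW] : exists n, [set w | mkseq w n = mkseq z n] `<=` W.
    by apply: cylinder_base; apply: open_nbhs_nbhs; split => //; exact: KW.
  exists ([set w | mkseq w m = mkseq z m], [set n | (m <= n)%N]) => /=.
    by split; [exact: cylinder_nbhs|exists m].
  move=> [y n] /= [yz mn] w wy; apply: mW => /=.
  by rewrite -yz; exact: mkseq_prefix wy.
by exists n => z w Kz; apply: (nP n) => //=.
Qed.

Lemma cylinder_compact c n : compact [set z : cantor_space | mkseq z n = c].
Proof.
apply: subclosed_compact cantor_space_compact _ => //.
rewrite -[X in closed X]setCK; apply: open_closedC; rewrite openE => z /= zc.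
by apply: filterS (cylinder_nbhs z n) => w /= ->.
Qed.

Lemma continuous_prefix (T : topologicalType) n (g : seq bool -> T) :
  continuous (fun z : cantor_space => g (mkseq z n)).
Proof.
move=> z U gU; apply: filterS (cylinder_nbhs z n) => w /= wz.
by rewrite wz; exact: nbhs_singleton.
Qed.

End CantorSpace.

Section FunctionSpace.
Context {X : topologicalType}.
Local Notation C := (continuous_maps cantor_space X).
Implicit Types (n : nat) (N : seq bool -> set X).

(** Boxes with open sides are a base of the compact-open topology that consists
of conditions on the values over finitely many cylinders. *)
Definition box n N : set C :=
  [set h : continuousType cantor_space X | forall z, N (mkseq z n) (h z)].

Lemma box_open n N : (forall c, open (N c)) -> open (box n N).
Proof.
move=> No; rewrite openE => h hN.
pose P (c : n.-tuple bool) : set C := [set g : continuousType cantor_space X |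
  g @` [set z | mkseq z n = c] `<=` N c].
have : nbhs h [set g | forall c, P c g].
  apply: (@filter_forall _ _ P (nbhs h) _) => c.
  apply: open_nbhs_nbhs; split; last by move=> _ [z zc <-]; rewrite -zc; exact: hN.
  exists [set g : {compact-open, cantor_space -> X} |
    g @` [set z : cantor_space | mkseq z n = c] `<=` N c] => //.
  by apply: compact_open_open => //; exact: cylinder_compact.
apply: filterS => g gN z.
by apply: (gN (Tuple (introT eqP (size_mkseq z n)))); exists z.
Qed.

Lemma box_neq0 n N : (forall c, N c !=set0) -> box n N !=set0.
Proof.
move=> /choice[g gN].
pose h : continuousType cantor_space X := mkcts (@continuous_prefix _ n g).
by exists h => z; exact: gN.
Qed.

Lemma box_raise n m N : (n <= m)%N -> box m (fun c => N (pad n c)) = box n N.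
Proof.
by move=> nm; apply/seteqP; split=> h hN z; have := hN z; rewrite pad_mkseq.
Qed.

(** The filter generated by the boxes around f converges to f in
the compact-open topology, as a compact set inside an open set has a cylinder
neighborhood of uniform level inside that set. *)
Lemma box_base (O : set C) (f : continuousType cantor_space X) :
  open O -> O f -> exists n N,
    [/\ forall c, open (N c), box n N f & box n N `<=` O].
Proof.
move=> [O' O'o <-] O'f.
pose D := [set p : nat * (seq bool -> set X) |
  (forall c, open (p.2 c)) /\ forall z, p.2 (mkseq z p.1) (f z)].
pose B (p : nat * (seq bool -> set X)) :=
  [set g : cantor_space -> X | forall z, p.2 (mkseq z p.1) (g z)].
pose F : set_system {compact-open, cantor_space -> X} := filter_from D B.
have FF : Filter F.
  apply: filter_from_filter.
    by exists (0%N, fun=> setT); split=> //= _; exact: openT.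
  move=> [n1 N1] [n2 N2] [/= N1o N1f] [/= N2o N2f].
  exists (maxn n1 n2, fun c => N1 (pad n1 c) `&` N2 (pad n2 c)) => /=.
    split=> /= [c|z]; first exact: openI.
    by rewrite !pad_mkseq ?leq_maxl ?leq_maxr.
  move=> g gN; split=> z /=; have /= [] := gN z;
    by rewrite !pad_mkseq ?leq_maxl ?leq_maxr.
have : F --> (f : {compact-open, cantor_space -> X}).
  apply/compact_open_cvgP => K U Kc Uo fKU.
  have [||n nP] := @compact_cylinders K (f @^-1` U) Kc.
  - by apply: open_comp => // z _; exact: cts_fun.
  - by move=> z Kz; apply: fKU; exists z.
  exists (n, fun c => if `[< exists2 z : cantor_space, K z & mkseq z n = c >]
    then U else setT).
    split=> [c|z] /=; first by case: asboolP => // _; exact: openT.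
    by case: asboolP => // -[w Kw E]; exact: (nP w z Kw (esym E)).
  move=> g gB _ [z Kz <-]; have /= := gB z.
  by case: asboolP => // nE; case: nE; exists z.
move=> /(_ _ (open_nbhs_nbhs (conj O'o O'f))) [[n N] [/= No Nf] NO].
by exists n, N; split => // g gN; exact: NO.
Qed.

End FunctionSpace.

(** * Generic maps *)

(** The closure of p + P lies in p + P - Q for every neighborhood Q of zero. *)
Lemma group_regular (X : topologicalZmodType) (O : set X) (p : X) :
  nbhs p O -> exists W, [/\ open W, W p & closure W `<=` O].
Proof.
move=> Op.
have hc : continuous (fun u : X * X => p + u.1 - u.2).
  apply: continuous_sub => [u|u]; last exact: cvg_snd.
  by apply: (@continuous_add _ _ (fun=> p) fst) => v; [exact: cvg_cst|exact: cvg_fst].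
have : nbhs (0 : X, 0 : X) [set u : X * X | O (p + u.1 - u.2)].
  by apply: hc => /=; rewrite subr0 addr0.
case=> [[P Q]] /= [P0 Q0] PQO.
have subc y : continuous (fun x : X => x - y).
  by apply: continuous_sub => z; [exact: cvg_id|exact: cvg_cst].
exists ((fun x => x - p) @^-1` P^°); split.
- by apply: open_comp => [y _|]; [exact: subc|exact: open_interior].
- by rewrite /preimage /= subrr.
- move=> y Wy.
  have : nbhs y [set x | Q (x - y)] by apply: (subc y y); rewrite subrr.
  move=> /Wy[x [/= /interior_subset Px Qx]].
  have -> : y = p + (x - p) - (x - y); last by apply: (PQO (x - p, x - y)).
  by rewrite [p + _]addrC subrK opprB addrC subrK.
Qed.

Section HaarOne.
Context {X : topologicalZmodType}.
Implicit Types (A : set X) (f : cantor_space -> X).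

Definition Haar1_witness A f : Prop :=
  forall x : X, is_subset1 (f @^-1` translate A x).

(** For one pair (i, j), fix y0 in N j: the open set N i - y0 contains an open
set G that misses F, and values near d + y0 and y0, with d in G, have their
difference in G. The pairs are treated one after the other. *)
Lemma separate_values (I : eqType) (F : set X) (l : seq (I * I)) (N : I -> set X) :
  nowhere_dense F -> (forall p, p \in l -> p.1 != p.2) ->
  (forall i, open (N i)) -> (forall i, N i !=set0) ->
  exists N' : I -> set X,
    [/\ forall i, open (N' i), forall i, N' i !=set0, forall i, N' i `<=` N i
      & forall p, p \in l -> forall x y, N' p.1 x -> N' p.2 y -> ~ F (x - y)].
Proof.
move=> /nowhere_denseP nF; elim: l N => [|[i j] l IH] N lP No N0.
  by exists N; split => // i x.
have [p pl|N' [N'o N'0 N'N N'F]] := IH N _ No N0.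
  by apply: lP; rewrite in_cons pl orbT.
have /= ij := lP _ (mem_head _ _).
have [x0 Ni] := N'0 i; have [y0 Nj] := N'0 j.
have subc y : continuous (fun x : X => x - y).
  by apply: continuous_sub => z; [exact: cvg_id|exact: cvg_cst].
have addc y : continuous (fun x : X => x + y).
  by apply: continuous_add => z; [exact: cvg_id|exact: cvg_cst].
have [||G [Go [d Gd] Gsub GF]] := nF ((fun d => d + y0) @^-1` N' i).
- by apply: open_comp => // x _; exact: addc.
- by exists (x0 - y0); rewrite /preimage /= subrK.
have /(@sub_continuous X (d + y0, y0)) : nbhs (d + y0 - y0) G.
  by rewrite addrK; exact: open_nbhs_nbhs.
case=> [[P Q]] /= [Pd Qy] PQG.
pose N'' k := if k == i then N' i `&` P^° else if k == j then N' j `&` Q^° else N' k.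
have N''N' k : N'' k `<=` N' k.
  by rewrite /N''; case: eqP => [->|_]; [|case: eqP => [->|_ //]]; exact: subIsetl.
exists N''; split.
- move=> k; rewrite /N''; case: ifP => _; [|case: ifP => _ //];
    by apply: openI => //; exact: open_interior.
- move=> k; rewrite /N''; case: ifP => _; [|case: ifP => _ //].
    by exists (d + y0); split; [exact: Gsub|exact: Pd].
  by exists y0; split; last exact: Qy.
- by move=> k; apply: subset_trans (N'N k).
- move=> [a b]; rewrite in_cons => /orP[/eqP[-> ->]|abl] x y /=; last first.
    by move=> /N''N' ax /N''N' bx; exact: (N'F _ abl).
  rewrite /N'' eqxx eq_sym (negbTE ij) eqxx => -[_ Px] [_ Qy'].
  by apply: GF; apply: (PQG (x, y)); split => /=; exact: interior_subset.
Qed.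

(** A box refined to level n has finitely many sides, and [separate_values] shrinks
them so that no difference of values over distinct words lies in F. *)
Lemma collision_nowhere_dense (F : set X) n : nowhere_dense F ->
  @nowhere_dense (continuous_maps cantor_space X)
    [set f : continuousType cantor_space X | exists s t : cantor_space,
       mkseq s n != mkseq t n /\ F (f s - f t)].
Proof.
move=> nF; apply/nowhere_denseP => O Oo [f Of].
have [n1 [N [No Nf NO]]] := box_base Oo Of.
pose m := maxn n n1.
have n1m : (n1 <= m)%N by exact: leq_maxr.
pose bits := [seq tval c | c <- enum {: m.-tuple bool}].
have bitsP (z : cantor_space) : mkseq z m \in bits.
  by apply/mapP; exists (Tuple (introT eqP (size_mkseq z m))); rewrite ?mem_enum.
pose l := [seq p <- [seq (c, d) | c <- bits, d <- bits] | p.1 != p.2].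
have [|||N' [N'o N'0 N'N N'F]] := @separate_values _ F l (fun c => N (pad n1 c)) nF.
- by move=> p; rewrite mem_filter => /andP[].
- by [].
- by move=> c; exists (f (nth false c)); exact: Nf.
exists (box m N'); split.
- exact: box_open.
- exact: box_neq0.
- apply: subset_trans NO; rewrite -(box_raise _ n1m) => g gN z.
  exact: N'N (gN z).
- move=> g gN [s [t [st]]]; apply: (N'F (mkseq s m, mkseq t m)); [|exact: gN|exact: gN].
  rewrite mem_filter /=; apply/andP; split; last first.
    by apply/allpairsP; exists (mkseq s m, mkseq t m); rewrite !bitsP.
  by apply: contra st => /eqP E; apply/eqP; apply: mkseq_prefix E; exact: leq_maxl.
Qed.

Lemma difference_meager_Haar1 A :
  meager (difference_set A) -> generically_Haar1 A.
Proof.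
move=> [F nF AF].
rewrite /generically_Haar1 /comeager.
pose E (p : nat * nat) := [set f : continuousType cantor_space X |
  exists s t : cantor_space, mkseq s p.2 != mkseq t p.2 /\ F p.1 (f s - f t)].
apply: (@meager_sub _ _ (\bigcup_p (E p : set (continuous_maps cantor_space X)))); last first.
  apply: meager_bigcup => -[m n]; apply: nowhere_dense_meager.
  exact: collision_nowhere_dense.
move=> f /=; apply: contra_notP => nE x s t [a Aa /= sa] [b Ab /= tb].
apply: contrapT => st; apply: nE.
have [n sn] : exists n, s n != t n.
  apply: contrapT => nst; apply: st; apply/funext => n.
  by apply/eqP; apply: contrapT => /negP sn; apply: nst; exists n.
have : difference_set A (f s - f t).
  by exists a => //; exists b => //; rewrite -sa -tb opprD addrACA subrr addr0.
rewrite AF => -[m _ Fm]; exists (m, n.+1) => //; exists s, t; split => //=.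
apply: contra sn => /eqP/(congr1 (fun c => nth false c n)).
by rewrite !nth_mkseq // => ->.
Qed.

(** The space of maps is Baire: choose nested boxes, the k-th of which avoids the
k-th nowhere dense set and has sides inside members of the k-th cover of X.
Over each point of the Cantor space the sides shrink to a point of X. As the
closure of each side lies in the previous one, the resulting map lies in all
the boxes. *)
Lemma generic_witness (V : nat -> nat -> set X) A :
  complete_covers V -> generically_Haar1 A ->
  exists2 f : cantor_space -> X, continuous f & Haar1_witness A f.
Proof.
move=> [Vo Vcov Vcomp] [F nF EF].
pose St := (nat * nat * (seq bool -> set X))%type.
pose P (u : St) := (forall c, open (u.2 c)) /\ (forall c, u.2 c !=set0).
(* A state (k, n, N) stands for the box of level n with sides N at step k. *)
pose R (u v : St) := [/\ v.1.1 = u.1.1.+1, (u.1.2 <= v.1.2)%N,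
  forall z : cantor_space, closure (v.2 (mkseq z v.1.2)) `<=` u.2 (mkseq z u.1.2),
  forall c, exists j, v.2 c `<=` V u.1.1 j
  & forall h : continuousType cantor_space X, box v.1.2 v.2 h -> ~ F u.1.1 h].
have [||u [u0 uP]] := @dependent_choice_in _ P R (0%N, 0%N, fun=> setT).
- by split=> c /=; [exact: openT|exists 0].
- move=> [[k n] N] [/= No N0].
  have /nowhere_denseP/(_ (box n N) (box_open n No) (box_neq0 n N0)) := nF k.
  move=> [O [Oo [f Of] ON OF]].
  have [n1 [N1 [N1o N1f N1O]]] := box_base Oo Of.
  have /choice[N' N'P] c : exists W, [/\ open W, W (f (nth false c)),
      closure W `<=` N (pad n c) `&` N1 (pad n1 c) & exists j, W `<=` V k j].
    have [j Vj] := Vcov k (f (nth false c)).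
    have [|W [Wo Wf Wsub]] := @group_regular _
        (N (pad n c) `&` N1 (pad n1 c) `&` V k j) (f (nth false c)).
      apply: open_nbhs_nbhs; split; first by do 2! [apply: openI => //].
      by split => //; split; [exact: (ON _ Of)|exact: N1f].
    exists W; split=> //; first by move=> x /Wsub[].
    by exists j => x /(@subset_closure _ W)/Wsub[].
  exists (k.+1, maxn n n1, N'); split; split=> //=.
  + by move=> c; have [] := N'P c.
  + by move=> c; exists (f (nth false c)); have [] := N'P c.
  + exact: leq_maxl.
  + move=> z x; have [_ _ + _] := N'P (mkseq z (maxn n n1)) => /[apply] -[].
    by rewrite pad_mkseq ?leq_maxl.
  + by move=> c; have [] := N'P c.
  + move=> h hN'; apply: OF; apply: N1O => z.
    have [_ _ + _] := N'P (mkseq z (maxn n n1)).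
    move=> /(_ _ (subset_closure (hN' z)))[_].
    by rewrite pad_mkseq ?leq_maxr.
have uk k : (u k).1.1 = k.
  by elim: k => [|k IH]; rewrite ?u0 //; have [_ [-> _ _ _ _]] := uP k; rewrite IH.
pose E (z : cantor_space) k := (u k).2 (mkseq z (u k).1.2).
have Edec z k : closure (E z k.+1) `<=` E z k.
  by have [_ [_ _ Ek _ _]] := uP k; exact: Ek.
have /choice[f fP] z : exists x, shrinks_to (fun k => E z k.+1) x.
  apply: Vcomp => k.
  - by have [[_ ne] _] := uP k.+1; exact: ne.
  - by apply: subset_trans (Edec z k.+1); exact: subset_closure.
  - by have [_ [_ _ _ small _]] := uP k; have := small (mkseq z (u k.+1).1.2); rewrite uk.
have Emono z i j : (i <= j)%N -> E z j `<=` E z i.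
  elim: j => [|j IH]; first by rewrite leqn0 => /eqP ->.
  rewrite leq_eqVlt ltnS => /orP[/eqP -> //|/IH]; apply: subset_trans.
  by apply: subset_trans (Edec z j); exact: subset_closure.
have fE z k : E z k (f z).
  apply: Edec => U /fP[j jU].
  have [[_ /(_ (mkseq z (u (maxn j k).+1).1.2))[x xE]] _] := uP (maxn j k).+1.
  exists x; split; first by apply: Emono xE; rewrite ltnS leq_maxr.
  by apply: jU; apply: Emono xE; rewrite ltnS leq_maxl.
have fc : continuous f.
  move=> z U /fP[k kU]; apply: filterS (cylinder_nbhs z (u k.+1).1.2) => w /= wz.
  by apply: kU; have := fE w k.+1; rewrite /E wz.
exists f => //.
pose h : continuousType cantor_space X := mkcts fc.
apply: contrapT => nf.
have : (~` [set f : continuousType cantor_space X |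
  forall x : X, is_subset1 (f @^-1` translate A x)]) h by [].
rewrite EF => -[k _ Fk].
have [_ [_ _ _ _ /(_ h)]] := uP k; rewrite uk; apply => //.
by move=> z; exact: (fE z k.+1).
Qed.

End HaarOne.

(** * Wedges and the addition game *)

Lemma nbhs0_add (X : topologicalZmodType) (U : set X) : nbhs (0 : X) U ->
  exists2 W, nbhs (0 : X) W & forall x y, W x -> W y -> U (x + y).
Proof.
move=> U0; have : nbhs (0 : X, 0 : X) [set u : X * X | U (u.1 + u.2)].
  by apply: add_continuous => /=; rewrite addr0.
case=> [[P Q]] /= [P0 Q0] PQU; exists (P `&` Q); first exact: filterI.
by move=> x y [Px _] [_ Qy]; exact: (PQU (x, y)).
Qed.

(** Let B be the part of A in a small closed neighborhood of zero. The set A - A is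
the union of the sets m(B - B), so one of them is nonmeager. By Pettis, every
small x satisfies m x = m((u + v') - (v + u')) with u, v, u', v' in B. Then
x + (v + u') differs from the point u + v' of A by an element annihilated by m,
so it lies in A; being the sum of three small elements, it is small. *)
Lemma wedge_small_differences (X : topologicalZmodType) (V : nat -> nat -> set X)
    (A : set X) :
  complete_covers V -> hausdorff_space X -> wedge A -> suslin A ->
  ~ meager (difference_set A) ->
  forall U, nbhs (0 : X) U -> nbhs (0 : X) (difference_set (A `&` U)).
Proof.
move=> XV Xh [M _ [_ Aadd AE Adiv]] sA nmA U U0.
have AH a t : A a -> @torsion_part X M t -> A (a + t).
  by move=> Aa Mt; rewrite AE; exists a => //; exists t.
have [W1 W10 W1U] := nbhs0_add U0; have [W2 W20 W2W1] := nbhs0_add W10.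
have [C [Co C0 CW2]] := group_regular W20.
have C'0 : nbhs (0 : X) (closure C).
  apply: filterS (@subset_closure _ C) _; exact: open_nbhs_nbhs.
pose B := A `&` closure C.
pose D m := [set (u - v) *+ m | u in B & v in B].
have [m [Mm nmD]] : exists m, M m /\ ~ meager (D m).
  apply: contrapT => nM; apply: nmA.
  apply: (@meager_sub _ _ (\bigcup_m (if `[< M m >] then D m else set0))).
    move=> _ [a Aa [b Ab <-]].
    have [u [v [[Au Cu] [Av Cv] [m Mm [-> ->]]]]] := Adiv a b _ Aa Ab C'0.
    exists m => //; case: asboolP => // _.
    by exists u => //; exists v => //; rewrite mulrnBl.
  apply: meager_bigcup => m; case: asboolP => [Mm|_]; last exact: meager0.
  by apply: contrapT => nmD; apply: nM; exists m.
have sB : suslin B by apply: suslin_closedI => //; exact: closed_closure.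
have sD : suslin (D m).
  apply: suslin_image2 => //; apply: continuous_mulrn.
  by apply: continuous_sub => p; [exact: cvg_fst|exact: cvg_snd].
have H : nbhs (0 : X) [set x | difference_set (D m) (x *+ m)].
  have mc : continuous (fun x : X => x *+ m).
    by apply: continuous_mulrn => x; exact: cvg_id.
  by apply: (mc (0 : X)); rewrite mul0rn; exact: suslin_pettis XV Xh sD nmD.
have W200 := nbhs_singleton W20; apply: filterS2 H W20.
move=> x [_ [u [Au Cu] [v [Av Cv] <-]] [_ [u' [Au' Cu'] [v' [Av' Cv'] <-]] xE]] W2x.
have Avu : A (v + u') by apply: Aadd; exists v => //; exists u'.
have Auv : A (u + v') by apply: Aadd; exists u => //; exists v'.
have Wvu : W1 (v + u') by apply: W2W1; exact: CW2.
exists (x + (v + u')); last first.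
  exists (v + u'); last by rewrite addrK.
  split=> //; rewrite -[v + u']addr0; apply: W1U => //.
  exact: nbhs_singleton.
split; last first.
  by apply: W1U => //; rewrite -[x]addr0; exact: W2W1.
have -> : x + (v + u') = (u + v') + (x + (v + u') - (u + v')).
  by rewrite [RHS]addrC subrK.
apply: AH => //; right; exists m => //=.
suff xm : x *+ m = (u + v') *+ m - (v + u') *+ m.
  by rewrite mulrnBl mulrnDl xm subrK subrr.
by rewrite -xE !mulrnDl !mulNrn opprB addrACA -opprD.
Qed.

Section AdditionGame.
Context {X : topologicalZmodType}.
Implicit Types (S : seq X -> set X) (h : seq (X * X)).

(** The moves that S allows after each of the histories obtained by choosing
one entry from every pair of h. There are finitely many of them, so that the
moves still form a neighborhood of zero. *)
Fixpoint robust_move S h : set X :=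
  if h is (a, b) :: h' then
    robust_move (fun s => S (a :: s)) h' `&` robust_move (fun s => S (b :: s)) h'
  else S [::].

Lemma robust_move_nbhs (A : set X) S h :
  (forall s, [set` s] `<=` A -> nbhs (0 : X) (S s)) ->
  (forall p, p \in h -> A p.1 /\ A p.2) -> nbhs (0 : X) (robust_move S h).
Proof.
elim: h S => [|[a b] h IH] S SA hA /=; first by apply: SA.
have [/= Aa Ab] := hA _ (mem_head _ _).
have hA' p : p \in h -> A p.1 /\ A p.2 by move=> ph; apply: hA; rewrite in_cons ph orbT.
apply: filterI; apply: IH => // s sA; apply: SA => x /=.
  by rewrite in_cons => /orP[/eqP -> //|/sA].
by rewrite in_cons => /orP[/eqP -> //|/sA].
Qed.

Lemma robust_move_sub (I : Type) S (s : seq I) (a b c : I -> X) :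
  (forall i, c i = a i \/ c i = b i) ->
  robust_move S [seq (a i, b i) | i <- s] `<=` S [seq c i | i <- s].
Proof.
move=> cab; elim: s S => [|i s IH] S //= x [xa xb].
by have [-> |->] := cab i; [exact: (IH _ x xa)|exact: (IH _ x xb)].
Qed.

(** D is allowed to depend on the indices n_j chosen before stage i. Both a_i and
b_i are robust moves with respect to the pairs (a_j, b_j) for j < i, so every
selection c is a play that is consistent with the strategy S. *)
Lemma game_selection (A : set X) S (D : seq nat -> nat -> X) :
  (forall s, [set` s] `<=` A -> nbhs (0 : X) (S s)) ->
  (forall a : X^nat, (forall n, A (a n)) -> (forall n, S (mkseq a n) (a n)) ->
    exists2 l : X, A l & series a @ \oo --> l) ->
  (forall U, nbhs (0 : X) U -> nbhs (0 : X) (difference_set (A `&` U))) ->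
  (forall s, D s @ \oo --> (0 : X)) ->
  exists (n : nat -> nat) (a b : nat -> X),
    [/\ {homo n : i j / (i < j)%N}, forall i, a i - b i = D (mkseq n i) (n i)
      & forall c : nat -> X, (forall i, c i = a i \/ c i = b i) ->
          exists2 l : X, A l & series c @ \oo --> l].
Proof.
move=> SA Swin Adiff D0.
pose P (h : seq (nat * (X * X))) := forall p, p \in h -> A p.2.1 /\ A p.2.2.
pose R (h h' : seq (nat * (X * X))) := exists m,
  [/\ h' = rcons h m, forall p, p \in h -> (p.1 < m.1)%N,
      m.2.1 - m.2.2 = D [seq p.1 | p <- h] m.1,
      (A `&` robust_move S [seq p.2 | p <- h]) m.2.1
    & (A `&` robust_move S [seq p.2 | p <- h]) m.2.2].
have [//|h hP|u [u0 uP]] := @dependent_choice_in _ P R [::].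
  have W0 : nbhs (0 : X) (robust_move S [seq p.2 | p <- h]).
    by apply: robust_move_nbhs SA _ => _ /mapP[p ph ->]; exact: hP.
  have [N _ NP] := D0 [seq p.1 | p <- h] _ (Adiff _ W0).
  pose n := maxn N (\max_(p <- h) p.1).+1.
  have [|a Wa [b Wb ab]] := NP n; first exact: leq_maxl.
  exists (rcons h (n, (a, b))); split.
    move=> p; rewrite mem_rcons in_cons => /orP[/eqP ->|/hP //].
    by split; [case: Wa|case: Wb].
  exists (n, (a, b)); split => // p ph /=.
  rewrite /n leq_max; apply/orP; right; rewrite ltnS.
  exact: (leq_bigmax_seq (F := fun p => p.1)).
have /choice[m mP] k : exists m, [/\ u k.+1 = rcons (u k) m,
      forall p, p \in u k -> (p.1 < m.1)%N,
      m.2.1 - m.2.2 = D [seq p.1 | p <- u k] m.1,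
      (A `&` robust_move S [seq p.2 | p <- u k]) m.2.1
    & (A `&` robust_move S [seq p.2 | p <- u k]) m.2.2] by have [] := uP k.
have uE k : u k = mkseq m k.
  by elim: k => [|k IH]; rewrite ?u0 // mkseqS; have [-> _ _ _ _] := mP k; rewrite IH.
exists (fun k => (m k).1), (fun k => (m k).2.1), (fun k => (m k).2.2); split.
- move=> i j ij; have [_ + _ _ _] := mP j; apply; rewrite uE.
  by apply/mapP; exists i => //; rewrite mem_iota.
- by move=> k; have [_ _ -> _ _] := mP k; rewrite uE -map_comp.
- move=> c cab; have cA k : A (c k).
    by have [_ _ _ [? _] [? _]] := mP k; have [->|->] := cab k.
  apply: Swin => // k.
  have [_ _ _ [_ ak] [_ bk]] := mP k.
  have : robust_move S [seq p.2 | p <- u k] (c k) by have [->|->] := cab k.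
  have -> : [seq p.2 | p <- u k] = [seq ((m i).2.1, (m i).2.2) | i <- iota 0 k].
    by rewrite uE -map_comp; apply: eq_map => i /=; case: (m i).2.
  exact: robust_move_sub.
Qed.

End AdditionGame.

(** * Flipping coordinates in the Cantor space *)

Lemma cvg_cantor (w : nat -> cantor_space) (z : cantor_space) :
  (forall j, \forall m \near \oo, w m j = z j) -> w @ \oo --> z.
Proof.
move=> wz U /cylinder_base[n nU].
suff : \forall m \near \oo, mkseq (w m) n = mkseq z n.
  by apply: filterS => m /= E; exact: nU.
elim: n {nU} => [|n IH]; first by near=> m.
apply: filterS2 IH (wz n) => m; rewrite !mkseqS => -> -> //.
Unshelve. all: by end_near. Qed.

Definition flip_on (z : cantor_space) (m : nat) : cantor_space :=
  fun j => z j || (j == m).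

Lemma cvg_flip_on z : flip_on z @ \oo --> z.
Proof.
apply: cvg_cantor => j; exists j.+1 => // m /= jm.
by rewrite /flip_on ltn_eqF ?orbF.
Qed.

Lemma cvg_flip_difference (X : topologicalZmodType) (f : cantor_space -> X) z :
  continuous f -> (fun m => f (flip_on z m) - f z) @ \oo --> (0 : X).
Proof.
move=> fc; rewrite -(subrr (f z)).
have gc : continuous (fun w => f w - f z).
  by apply: continuous_sub => // w; exact: cvg_cst.
apply: (@cvg_comp _ _ _ (flip_on z) (fun w => f w - f z) _ (nbhs z)).
  exact: cvg_flip_on.
exact: gc.
Qed.

(** * The ordinal omega + 1 *)

Local Notation Omega := (order_topology omega_succ).

Lemma omega_ltS (m n : nat) :
  ((Some m : Omega) < (Some n : Omega))%O = (m < n)%N.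
Proof. by rewrite lt_neqAle ltn_neqAle; congr (~~ _ && _). Qed.

Lemma omega_top_lt (x : Omega) : ((None : Omega) < x)%O = false.
Proof. by rewrite lt_neqAle; case: x. Qed.

Lemma cvg_omega :
  (Some : nat -> Omega) @ \oo --> (None : Omega).
Proof.
move=> U; rewrite order_nbhs_itv => -[[lo hi] [oi]].
rewrite [_ \in _]in_itv; case: hi oi => [b h|b] oi.
  by move: (itv_open_ends_rside oi) => ->; rewrite /= omega_top_lt andbF.
move: (oi); rewrite (itv_open_ends_rinfty oi) => {}oi.
case: lo oi => [c l|c] oi; last first.
  rewrite (itv_open_ends_linfty oi) => _ iU; exists 0%N => // n _.
  by apply: iU => /=; rewrite in_itv.
rewrite (itv_open_ends_lside oi) /= andbT; case: l {oi} => [m _|]; last by rewrite ltxx.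
move=> iU; exists m.+1 => // n mn; apply: iU => /=.
by rewrite [_ \in _]in_itv /= andbT omega_ltS.
Qed.

(** * Branches of the binary tree *)

Section Branches.
Implicit Types (y : nat -> bool) (k i : nat).

(** Heap numbering of the binary tree: the children of v are 2v and 2v + 1. Nodes
have greater numbers than their ancestors, so that a recursion over the numbers
handles the ancestors of a node first. *)
Fixpoint node y k : nat := if k is k'.+1 then (node y k').*2 + y k' else 1.

Lemma node_gt0 y k : (0 < node y k)%N.
Proof. by elim: k => //= k IH; rewrite addn_gt0 double_gt0 IH. Qed.

Lemma node_mono y k l : (k < l)%N -> (node y k < node y l)%N.
Proof.
elim: l => // l IH; rewrite ltnS leq_eqVlt => kl.
have ll : (node y l < node y l.+1)%N.
  by rewrite /= -addnn -addnA -addn1 leq_add2l addn_gt0 node_gt0.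
by case/orP: kl => [/eqP -> //|/IH kl]; exact: ltn_trans ll.
Qed.

Lemma node_inj y y' k k' : node y k = node y' k' ->
  k = k' /\ forall j, (j < k)%N -> y j = y' j.
Proof.
elim: k k' => [|k IH] [|k'] //=.
- by have := node_gt0 y' k'; case: node => // n _; rewrite doubleS.
- by have := node_gt0 y k; case: node => // n _; rewrite doubleS.
move=> E; have yk : y k = y' k'.
  by have := congr1 odd E; rewrite !oddD !odd_double !oddb.
have {}E : node y k = node y' k'.
  by have := congr1 half E; rewrite yk ![(_.*2 + _)%N]addnC !half_bit_double.
have [kk yy] := IH _ E; rewrite -kk in yk *; split=> // j.
by rewrite ltnS leq_eqVlt => /orP[/eqP ->|/yy].
Qed.

Lemma node_eq y y' k : (forall j, (j < k)%N -> y j = y' j) -> node y k = node y' k.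
Proof.
elim: k => //= k IH yy; rewrite IH ?yy // => j jk; apply: yy; exact: ltnW.
Qed.

Definition on_branch y i : bool := `[< exists k, node y k = i >].

(** A node determines its ancestors. *)
Lemma on_branch_coherent y y' m i : on_branch y m -> on_branch y' m -> (i < m)%N ->
  on_branch y i = on_branch y' i.
Proof.
wlog suff: y y' / on_branch y m -> on_branch y' m -> (i < m)%N ->
    on_branch y i -> on_branch y' i.
  by move=> H ym y'm im; apply/idP/idP; apply: H.
move=> /asboolP[k <-] /asboolP[k' E] im /asboolP[j yj].
have [kk yy] := node_inj E; apply/asboolP; exists j; rewrite -yj.
apply: node_eq => l lj; apply: yy; rewrite kk; apply: ltn_trans lj _.
rewrite ltnNge leq_eqVlt; apply/negP => /orP[/eqP kj|/(@node_mono y)].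
  by move: im; rewrite -yj kj ltnn.
by rewrite yj ltnNge (ltnW im).
Qed.

Lemma on_branch_inj y y' : (forall i, on_branch y i -> on_branch y' i) -> y = y'.
Proof.
move=> yy; apply/funext => k.
have /asboolP[k' E] : on_branch y' (node y k.+1) by apply: yy; apply/asboolP; exists k.+1.
have [kk yk] := node_inj E; by rewrite yk // kk.
Qed.

(** The point reached along the branch y before stage N: stage i contributes
the coordinate n_i if the node i lies on y. *)
Definition marks (n : nat -> nat) (N : nat) y : cantor_space :=
  fun j => has (fun i => on_branch y i && (n i == j)) (iota 0 N).

Lemma marksS n N y : marks n N.+1 y =
  if on_branch y N then flip_on (marks n N y) (n N) else marks n N y.
Proof.
apply/funext => j; rewrite /marks -addn1 iotaD has_cat /= orbF add0n.
by case: ifP => _; rewrite ?orbF // /flip_on eq_sym.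
Qed.

Lemma eq_marks n n' N y y' : (forall i, (i < N)%N -> n i = n' i) ->
  (forall i, (i < N)%N -> on_branch y i = on_branch y' i) ->
  marks n N y = marks n' N y'.
Proof.
move=> nn yy; apply/funext => j; apply: eq_in_has => i.
by rewrite mem_iota add0n => iN; rewrite nn // yy.
Qed.

Definition marks_lim (n : nat -> nat) y : cantor_space :=
  fun j => `[< exists i, on_branch y i /\ n i = j >].

Lemma cvg_marks n y : {homo n : i j / (i < j)%N} ->
  (marks n ^~ y) @ \oo --> marks_lim n y.
Proof.
move=> nmono; apply: cvg_cantor => j; exists j.+1 => // N /= jN.
apply/idP/idP => [/hasP[i _ /andP[yi /eqP nij]]|/asboolP[i [yi nij]]].
  by apply/asboolP; exists i.
apply/hasP; exists i; last by rewrite yi nij eqxx.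
rewrite mem_iota add0n; apply: leq_ltn_trans jN; rewrite -nij.
by elim: i {yi nij} => // i IH; apply: leq_ltn_trans IH _; exact: nmono.
Qed.

Lemma marks_lim_inj n : {homo n : i j / (i < j)%N} -> injective (marks_lim n).
Proof.
move=> nmono y y' E; apply: on_branch_inj => i yi.
have : marks_lim n y' (n i) by rewrite -E; apply/asboolP; exists i.
move=> /asboolP[i' [yi' nii]]; suff -> : i = i' by [].
by case: (ltngtP i i') => // /nmono; rewrite nii ltnn.
Qed.

End Branches.

(** Cantor's diagonal argument. *)
Lemma uncountable_sequences (g : (nat -> bool) -> nat) : ~ injective g.
Proof.
move=> gi; pose y n := `[< exists2 y', g y' = n & ~~ y' n >].
have : y (g y) <-> ~~ y (g y).
  split=> [/asboolP[y' /gi -> //]|ny]; apply/asboolP; by exists y.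
by case: (y (g y)) => -[a b]; [case: (negP (a isT))|case: notF; exact: b].
Qed.

(** * Consequences of a generic map *)

Section Implications.
Context {X : topologicalZmodType}.
Variables (A : set X).

Lemma Haar1_thin f : continuous f -> Haar1_witness A f -> Haar_thin A.
Proof.
by move=> fc f1; exists f => // x n y z; rewrite !inE => yx zx _; exact: f1 yx zx.
Qed.

Lemma Haar1_countable f : continuous f -> Haar1_witness A f -> Haar_countable A.
Proof.
move=> fc f1; exists f => // x; apply/countable_injP; exists (fun=> 0%N).
by move=> y z; rewrite !inE => yx zx _; exact: f1 yx zx.
Qed.

Definition omega_cantor (t : Omega) : cantor_space :=
  fun j => t == Some j.

Lemma omega_cantor_continuous : continuous omega_cantor.
Proof.
move=> t U tU.
have [n nU] := cylinder_base tU.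
suff : nbhs t [set s | mkseq (omega_cantor s) n = mkseq (omega_cantor t) n].
  by apply: filterS => s /= E; exact: nU.
case: t {tU nU} => [i|].
  have : nbhs (Some i : Omega) (`]-oo, (Some i.+1 : Omega)[%classic `&`
      (if i is i'.+1 then `](Some i' : Omega), +oo[%classic else setT)).
    apply: open_nbhs_nbhs; split.
      by apply: openI; [exact: lray_open|case: (i) => [|i']; [exact: openT|exact: rray_open]].
    split; first by rewrite /= in_itv /= omega_ltS.
    by case: (i) => // i'; rewrite /= in_itv /= omega_ltS ltnS leqnn.
  apply: filterS => -[j|] /=; last by rewrite in_itv /= omega_top_lt => -[].
  rewrite in_itv /= omega_ltS ltnS => -[ji] Hj; suff -> : i = j by [].
  apply/eqP; rewrite eqn_leq ji andbT; case: (i) Hj => //= i'.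
  by rewrite in_itv /= omega_ltS andbT.
have : nbhs (None : Omega) `](Some n : Omega), +oo[%classic.
  apply: open_nbhs_nbhs; split; first exact: rray_open.
  by rewrite /= in_itv.
apply: filterS => -[j|] //=; rewrite in_itv /= omega_ltS andbT => nj.
apply/eq_in_map => k; rewrite mem_iota add0n /omega_cantor => kn.
have kj : (k < j)%N by exact: ltn_trans nj.
by apply/eqP => -[jk]; move: kj; rewrite jk ltnn.
Qed.

Lemma Haar1_null_finite f : continuous f -> Haar1_witness A f -> null_finite A.
Proof.
move=> fc f1; exists (f \o omega_cantor).
  by move=> t; apply: continuous_comp; [exact: omega_cantor_continuous|exact: fc].
move=> x; set B := _ @^-1` _.
have [->|/set0P[s sB]] := eqVneq B set0; first exact: finite_set0.
apply: (@sub_finite_set _ _ [set s]); last exact: finite_set1.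
move=> t tB /=; have E := f1 x _ _ tB sB.
case: t {tB} E => [i|] E.
  have := congr1 (fun z : cantor_space => z i) E.
  by rewrite /omega_cantor eqxx => /esym/eqP.
case: s {sB} E => [i|//] E.
by have := congr1 (fun z : cantor_space => z i) E; rewrite /omega_cantor eqxx.
Qed.

(** If f (flip_on z m) - f z = a - b, then z and flip_on z m, which differ in the
coordinate m only, are both sent to the translate of A by f z - b. *)
Lemma thin_not_open : A !=set0 -> Haar_thin A -> ~ open (difference_set A).
Proof.
move=> [a0 Aa0] [f fc fthin] Ao.
pose z : cantor_space := fun=> false.
have A0 : nbhs (0 : X) (difference_set A).
  apply: open_nbhs_nbhs; split => //.
  by exists a0 => //; exists a0 => //; rewrite subrr.
have [m _ /(_ m (leqnn m)) [a Aa [b Ab ab]]] := cvg_flip_difference z fc A0.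
have zm : flip_on z m m by rewrite /flip_on eqxx orbT.
suff E : flip_on z m = z by move: zm; rewrite E.
apply: (fthin (f z - b) m); rewrite ?inE.
- by exists a => //; rewrite addrCA ab addrC subrK.
- by exists b => //; rewrite addrC subrK.
- apply/funext => -[j jm] /=; rewrite /sigL /= /set_val /=.
  have /eqP/negbTE jm' : j <> m by move: jm; rewrite inE.
  by rewrite /flip_on jm' orbF.
Qed.

End Implications.

(** * Consequences of the addition game *)

Section GameConsequences.
Context {X : topologicalZmodType}.
Variables (A : set X).

Lemma cvg_series_sub (u v : nat -> X) (l l' d : X) :
  hausdorff_space X -> series u @ \oo --> l -> series v @ \oo --> l' ->
  (fun n => series u n - series v n) @ \oo --> d -> d = l - l'.
Proof.
move=> Xh ul vl uvd; apply: (cvg_unique Xh uvd).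
apply: (@cvg_comp _ _ _ (fun n => (series u n, series v n))
  (fun p : X * X => p.1 - p.2) _ (nbhs (l, l')));
  last exact: (@sub_continuous X (l, l')).
exact: cvg_pair.
Qed.

Hypothesis Xh : hausdorff_space X.
Hypothesis A_winning : winning_additive A.
Hypothesis A_diff :
  forall U, nbhs (0 : X) U -> nbhs (0 : X) (difference_set (A `&` U)).

(** All stages use the same sequence f n - f omega. Replacing b_k by a_k
in the series of the b_i changes its sum by f n_k - f omega. *)
Lemma not_null_finite : ~ null_finite A.
Proof.
move=> [f fc ffin]; have [_ _ [S [SA Swin]]] := A_winning.
pose D (s : seq nat) (m : nat) := f (Some m) - f None.
have D0 s : D s @ \oo --> (0 : X).
  rewrite -(subrr (f None)).
  have gc : continuous (fun t => f t - f None).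
    by apply: continuous_sub; [exact: fc|exact: cst_continuous].
  apply: (@cvg_comp _ _ _ Some (fun t => f t - f None) _ (nbhs (None : Omega))).
    exact: cvg_omega.
  exact: gc.
have [n [a [b [nmono ab cvg]]]] := game_selection SA Swin A_diff D0.
have [|l' Al' bl'] := cvg b; first by right.
have ninj : {in (fun k => Some (n k) : Omega) @^-1`
    (f @^-1` translate A (f None - l')) &, injective (fun k => Some (n k) : Omega)}.
  by move=> i j _ _ [E]; case: (ltngtP i j) => // /nmono; rewrite E ltnn.
have := finite_preimage ninj (ffin (f None - l')).
suff -> : (fun k => Some (n k) : Omega) @^-1` (f @^-1` translate A (f None - l')) = setT.
  exact: infinite_nat.
apply/seteqP; split=> // k _.
pose c i := if i == k then a i else b i.
have [i|l Al cl] := cvg c; first by rewrite /c; case: eqP; [left|right].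
exists l => //.
suff abl : a k - b k = l - l' by rewrite addrCA -abl ab /D addrC subrK.
apply: cvg_series_sub Xh cl bl' _.
have E N : series c N - series b N = if (k < N)%N then a k - b k else 0.
  elim: N => [|N IH]; first by rewrite /series /= !big_geq // subrr.
  rewrite !seriesSr opprD addrACA IH ltnS /c.
  by case: (ltngtP N k) => [||->]; rewrite ?subrr ?add0r ?addr0.
apply: cvg_near_cst; exists k.+1 => // N /= kN.
by rewrite E kN.
Qed.

(** Stage m uses the differences f (flip_on z j) - f z for the point z that is
attached to the node m; by [on_branch_coherent] the point z is the same for
all branches through m. Along a branch y, the partial sums of c_i - b_i
telescope to the values of f at the points [marks n N y]. *)
Lemma not_Haar_countable : ~ Haar_countable A.
Proof.
move=> [f fc fcount]; have [_ _ [S [SA Swin]]] := A_winning.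
(* Any branch through m will do; the default is used only if there is none. *)
pose branch m := xget (fun=> false) [set y | on_branch y m].
pose state (s : seq nat) := marks (nth 0%N s) (size s) (branch (size s)).
pose D (s : seq nat) (m : nat) := f (flip_on (state s) m) - f (state s).
have [n [a [b [nmono ab cvg]]]] :=
  game_selection SA Swin A_diff (fun s => cvg_flip_difference (state s) fc).
have [|l' Al' bl'] := cvg b; first by right.
pose x := f (fun=> false) - l'.
have ylim y : (f @^-1` translate A x) (marks_lim n y).
  pose c i := if on_branch y i then a i else b i.
  have [i|l Al cl] := cvg c; first by rewrite /c; case: ifP; [left|right].
  exists l => //.
  suff fl : f (marks_lim n y) - f (fun=> false) = l - l'.
    by rewrite /x addrCA -fl addrC subrK.
  apply: cvg_series_sub Xh cl bl' _.
  have E N : series c N - series b N = f (marks n N y) - f (fun=> false).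
    elim: N => [|N IH]; first by rewrite /series /= !big_geq // !subrr.
    rewrite !seriesSr opprD addrACA IH marksS /c.
    case: ifP => yN; last by rewrite subrr addr0.
    have -> : marks n N y = state (mkseq n N).
      rewrite /state size_mkseq; apply: eq_marks => i iN; first by rewrite nth_mkseq.
      apply: (on_branch_coherent yN _ iN).
      by rewrite /branch; case: xgetP => [_ -> //|/(_ y)]; rewrite /= yN.
    by rewrite ab addrC addrA subrK.
  rewrite (_ : (fun=> _) = fun N => f (marks n N y) - f (fun=> false)).
    have gc : continuous (fun w => f w - f (fun=> false)).
      by apply: continuous_sub => // w; exact: cvg_cst.
    apply: (@cvg_comp _ _ _ (marks n ^~ y) (fun w => f w - f (fun=> false)) _
      (nbhs (marks_lim n y))); last exact: gc.
    exact: cvg_marks.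
  by apply/funext => N; exact: E.
have [h hinj] := countable_injP _ (fcount x).
apply: (@uncountable_sequences (h \o marks_lim n)) => y y' /= /hinj E.
by apply: (marks_lim_inj nmono); apply: E; rewrite inE.
Qed.

End GameConsequences.

(** * The equivalence *)

Theorem theorem18p14 (R : realType) (X : topologicalZmodType) (A : set X)
    (X_polish : polish R X)
    (A_wedge : wedge A)
    (A_analytic : analytic_space R (set_type A))
    (A_winning : winning_additive A) :
  [<-> ~ open (difference_set A);
       meager (difference_set A);
       generically_Haar1 A;
       Haar_thin A;
       null_finite A;
       Haar_countable A].
Proof.
have [V XV] := polish_complete_covers X_polish.
have Xh := polish_hausdorff X_polish.
have sA := analytic_suslin A_analytic.
have [A0 Aadd] : A !=set0 /\ additive_set A by have [M _ []] := A_wedge.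
have witness_of_meager : meager (difference_set A) ->
    exists2 f : cantor_space -> X, continuous f & Haar1_witness A f.
  by move/difference_meager_Haar1/(generic_witness XV).
have not_open_of_meager : meager (difference_set A) -> ~ open (difference_set A).
  by move=> /witness_of_meager[f fc /(Haar1_thin fc)]; exact: thin_not_open.
(* By Pettis, G - G is a neighborhood of zero, and G - G = G for G = A - A. *)
have meager_of_not_open : ~ open (difference_set A) -> meager (difference_set A).
  apply: contra_notP => nm.
  have sAA : suslin (difference_set A).
    by apply: suslin_image2 => //; exact: sub_continuous.
  have H := suslin_pettis XV Xh sAA nm.
  rewrite openE => p [a Aa [b Ab abp]].
  have pc : continuous (fun y : X => y - p).
    by apply: continuous_sub => y; [exact: cvg_id|exact: cvg_cst].
  have : nbhs p [set y | difference_set (difference_set A) (y - p)].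
    by apply: (pc p); rewrite subrr.
  apply: filterS => y [_ [c Ac [d Ad <-]] [_ [c' Ac' [d' Ad' <-]] yp]].
  have AD x z : A x -> A z -> A (x + z).
    by move=> Ax Az; apply: Aadd; exists x => //; exists z.
  exists (a + (c + d')); first by apply: (AD) => //; exact: AD.
  exists (b + (d + c')); first by apply: (AD) => //; exact: AD.
  rewrite opprD addrACA abp -[RHS](subrK p) -yp [RHS]addrC; congr (_ + _).
  by rewrite opprB addrACA -opprD.
have diff_of_open : ~ meager (difference_set A) -> forall U : set X,
    nbhs (0 : X) U -> nbhs (0 : X) (difference_set (A `&` U)).
  by move=> nm; exact: (wedge_small_differences XV Xh A_wedge sA nm).
have meager_of_null : null_finite A -> meager (difference_set A).
  by move=> An; apply: contrapT => /diff_of_open/(not_null_finite Xh A_winning).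
have meager_of_countable : Haar_countable A -> meager (difference_set A).
  by move=> An; apply: contrapT => /diff_of_open/(not_Haar_countable Xh A_winning).
tfae.
- exact: meager_of_not_open.
- exact: difference_meager_Haar1.
- by move=> /(generic_witness XV)[f fc]; exact: Haar1_thin.
- move=> /(thin_not_open A0)/meager_of_not_open/witness_of_meager[f fc].
  exact: Haar1_null_finite.
- by move=> /meager_of_null/witness_of_meager[f fc]; exact: Haar1_countable.
- by move=> /meager_of_countable/not_open_of_meager.
Qed.
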